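(* Let $n,d,C\ge 1$ be integers, let $y_1,\dots,y_n\in\{1,\dots,C\}$ be labels such that each class has at least two indices $i$ with that label, and let $\tau,\epsilon,\alpha,\beta>0$. Let $Z=[z_1,\dots,z_n]\in\mathbb{R}^{d\times n}$, let $\mathcal{J}:\mathbb{R}^{d\times n}\to\mathbb{R}$ be the leave-one-out objective, and set $F=-\nabla_Z\mathcal{J}(Z)\in\mathbb{R}^{d\times n}$ and $K=[\kappa(z_i,z_j)]_{i,j=1}^n+\epsilon I_n\succ 0$, where $\kappa(z,z')=\exp(\tau z^\top z')$. Consider the regularized local objective, with $F$ and $K$ held fixed at their values at $Z$, $$\mathcal{Q}(U)=-\langle F,U\rangle+\frac{\beta}{2}\lVert U\rVert_F^2+\frac{\alpha}{2}\operatorname{tr}(UK^{-1}U^\top),\qquad U\in\mathbb{R}^{d\times n}.$$ Then the minimizer $U^*$ of $\mathcal{Q}$ over $\mathbb{R}^{d\times n}$ is $$U^*=FK(\beta K+\alpha I_n)^{-1},$$ and if $\mathcal{J}$ is $\beta$-smooth on a neighborhood containing the update segment $\{Z+tU^*:t\in[0,1]\}$, then $$\mathcal{J}(Z+U^* )-\mathcal{J}(Z)\le-\tfrac12\langle F,U^*\rangle\le 0.$$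
   Context: For $Z=[z_1,\dots,z_n]\in\mathbb{R}^{d\times n}$ with columns $z_i\in\mathbb{R}^d$ and for $j\neq i$ define $$a_{ij}(Z)=\frac{\kappa(z_i,z_j)}{\sum_{k\ne i}\kappa(z_i,z_k)},\qquad q_i(Z)=\sum_{j\ne i}a_{ij}(Z)\,\mathbb{1}[y_j=y_i],\qquad \kappa(z,z')=\exp(\tau z^\top z').$$ The leave-one-out objective is $$\mathcal{J}(Z)=-\frac1n\sum_{i=1}^n\log q_i(Z),$$ which is finite because every class has at least two rows. $\nabla_Z\mathcal{J}$ is the gradient with respect to the Frobenius inner product $\langle A,B\rangle=\operatorname{tr}(A^\top B)$, $\lVert\cdot\rVert_F$ is the Frobenius norm, and $I_n$ is the $n\times n$ identity. ''$\beta$-smooth on a set'' means that $\nabla\mathcal{J}$ is Lipschitz on that set with constant $\beta$ with respect to the Frobenius norm. *)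

(* Defs.v *)
From HB Require Import structures.
From mathcomp Require Export all_boot all_order all_algebra.
From mathcomp Require Export all_classical all_reals all_analysis.

Set Implicit Arguments.
Unset Strict Implicit.
Unset Printing Implicit Defensive.

Export Order.TTheory GRing.Theory Num.Theory numFieldNormedType.Exports.

Local Open Scope classical_set_scope.
Local Open Scope ring_scope.

Definition frob (R : realType) (m n : nat) (A B : 'M[R]_(m, n)) : R :=
  \tr (A^T *m B).

(* The norm that MathComp-Analysis puts on matrices is the max norm; it induces
   the same topology and the same differentials as the Frobenius norm, but not
   the same Lipschitz constants. *)
Definition frob_norm (R : realType) (m n : nat) (A : 'M[R]_(m, n)) : R :=
  Num.sqrt (frob A A).

(* The representative of the Frechet differential of [f] at [Z] for the
   Frobenius inner product: see [gradP] and [grad_unique].  It is meaningful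
   only where [f] is differentiable; [loo_objective] is differentiable
   everywhere, see [loo_objective_differentiable]. *)
Definition grad (R : realType) (m n : nat) (f : 'M[R]_(m, n) -> R)
    (Z : 'M[R]_(m, n)) : 'M[R]_(m, n) :=
  \matrix_(i, j) ('d f Z (delta_mx i j) : R).

Lemma frob_sum (R : realType) (m n : nat) (A B : 'M[R]_(m, n)) :
  frob A B = \sum_i \sum_j A i j * B i j.
Proof.
rewrite /frob /mxtrace exchange_big /=; apply: eq_bigr => j _.
by rewrite mxE; apply: eq_bigr => i _; rewrite mxE.
Qed.

Lemma gradP (R : realType) (m n : nat) (f : 'M[R]_(m, n) -> R)
    (Z U : 'M[R]_(m, n)) :
  'd f Z U = frob (grad f Z) U.
Proof.
rewrite frob_sum {1}(matrix_sum_delta U) linear_sum; apply: eq_bigr => i _.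
rewrite linear_sum; apply: eq_bigr => j _.
by rewrite linearZ mxE mulrC.
Qed.

Lemma grad_unique (R : realType) (m n : nat) (f : 'M[R]_(m, n) -> R)
    (Z G : 'M[R]_(m, n)) :
  (forall U, 'd f Z U = frob G U) -> G = grad f Z.
Proof.
move=> GE; apply/matrixP => i j; rewrite mxE GE frob_sum (bigD1 i) //=.
rewrite (bigD1 j) //= !mxE !eqxx mulr1 !big1 ?addr0 // => [k ki|k kj].
  by rewrite big1 // => l _; rewrite mxE (negPf ki) mulr0.
by rewrite mxE (negPf kj) andbF mulr0.
Qed.

Definition smooth_on (R : realType) (m n : nat) (beta : R)
    (f : 'M[R]_(m, n) -> R) (S : set 'M[R]_(m, n)) : Prop :=
  forall A B, S A -> S B ->
    frob_norm (grad f A - grad f B) <= beta * frob_norm (A - B).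

Definition posdef (R : realType) (n : nat) (K : 'M[R]_n) : Prop :=
  K^T = K /\ forall v : 'cV[R]_n, v != 0 -> 0 < (v^T *m K *m v) 0 0.

Definition minimizer (T : Type) (R : realType) (Q : T -> R) (u : T) : Prop :=
  forall v, Q u <= Q v.

Definition kappa (R : realType) (d : nat) (tau : R) (z z' : 'cV[R]_d) : R :=
  expR (tau * (z^T *m z') 0 0).

Definition attn (R : realType) (d n : nat) (tau : R) (Z : 'M[R]_(d, n))
    (i j : 'I_n) : R :=
  kappa tau (col i Z) (col j Z) /
  \sum_(k < n | k != i) kappa tau (col i Z) (col k Z).

Definition loo_prob (R : realType) (d n C : nat) (tau : R) (y : 'I_n -> 'I_C)
    (Z : 'M[R]_(d, n)) (i : 'I_n) : R :=
  \sum_(j < n | j != i) attn tau Z i j * (y j == y i)%:R.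

Definition loo_objective (R : realType) (d n C : nat) (tau : R)
    (y : 'I_n -> 'I_C) (Z : 'M[R]_(d, n)) : R :=
  - (n%:R^-1 * \sum_(i < n) ln (loo_prob tau y Z i)).

Definition reg_kernel (R : realType) (d n : nat) (tau eps : R)
    (Z : 'M[R]_(d, n)) : 'M[R]_n :=
  (\matrix_(i, j) kappa tau (col i Z) (col j Z)) + eps%:M.

Definition local_objective (R : realType) (d n : nat) (alpha beta : R)
    (F : 'M[R]_(d, n)) (K : 'M[R]_n) (U : 'M[R]_(d, n)) : R :=
  - frob F U + beta / 2 * frob_norm U ^+ 2
  + alpha / 2 * \tr (U *m invmx K *m U^T).

Lemma kappa_differentiable (R : realType) (d n : nat) (tau : R) (i j : 'I_n)
    (Z : 'M[R]_(d, n)) :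
  differentiable (fun Y : 'M[R]_(d, n) => kappa tau (col i Y) (col j Y)) Z.
Proof.
apply: (@differentiable_comp _ _ _ _
  (fun Y : 'M[R]_(d, n) => tau * ((col i Y)^T *m col j Y) 0 0) expR).
  rewrite (_ : (fun _ => _) =
      \sum_(k < d) (fun Y : 'M[R]_(d, n) => tau * (Y k i * Y k j))); last first.
    apply/funext => Y; rewrite fct_sumE mxE mulr_sumr.
    by apply: eq_bigr => k _; rewrite !mxE.
  apply: differentiable_sum => k; apply: differentiableM => //.
  by apply: differentiableM; exact: differentiable_coord.
by apply/derivable1_diffP; exact: derivable_expR.
Qed.

Lemma kappa_gt0 (R : realType) (d : nat) (tau : R) (z z' : 'cV[R]_d) :
  0 < kappa tau z z'.
Proof. exact: expR_gt0. Qed.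

Lemma loo_prob_gt0 (R : realType) (d n C : nat) (tau : R) (y : 'I_n -> 'I_C)
    (Z : 'M[R]_(d, n)) (i : 'I_n) :
  (2 <= #|[set j | y j == y i]%SET|)%N -> 0 < loo_prob tau y Z i.
Proof.
move=> /card_gt1P[a [b [ya yb ab]]].
have [j ji yj] : exists2 j, j != i & y j == y i.
  have [ai|ai] := eqVneq a i; last by exists a => //; rewrite inE in ya.
  by exists b; [rewrite -ai eq_sym|rewrite inE in yb].
have S0 : 0 < \sum_(k < n | k != i) kappa tau (col i Z) (col k Z).
  rewrite (bigD1 j) //= ltr_pwDl ?kappa_gt0// sumr_ge0// => k _.
  exact/ltW/kappa_gt0.
rewrite /loo_prob (bigD1 j) //= yj mulr1 ltr_pwDl ?divr_gt0 ?kappa_gt0//.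
rewrite sumr_ge0// => k _; apply: mulr_ge0 => //.
by apply: divr_ge0; apply: ltW => //; exact: kappa_gt0.
Qed.

Lemma loo_prob_differentiable (R : realType) (d n C : nat) (tau : R)
    (y : 'I_n -> 'I_C) (Z : 'M[R]_(d, n)) (i j : 'I_n) : j != i ->
  differentiable (fun Y : 'M[R]_(d, n) => loo_prob tau y Y i) Z.
Proof.
move=> ji.
pose k (l : 'I_n) (Y : 'M[R]_(d, n)) := kappa tau (col i Y) (col l Y).
have dsum (f : 'I_n -> 'M[R]_(d, n) -> R) : (forall l, differentiable (f l) Z) ->
    differentiable (fun Y => \sum_(l < n | l != i) f l Y) Z.
  move=> df; rewrite (_ : (fun _ => _) = \sum_(l < n | l != i) f l); last first.
    by apply/funext => Y; rewrite fct_sumE.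
  elim/big_ind : _ => [|? ? ? ?|l _]; first exact: differentiable_cst.
    exact: differentiableD.
  exact: df.
apply: (dsum) => l; apply: differentiableM; last exact: differentiable_cst.
apply: differentiableM; first exact: kappa_differentiable.
apply: differentiableV; first by apply: dsum => m; exact: kappa_differentiable.
rewrite gt_eqF// (bigD1 j) //= ltr_pwDl ?kappa_gt0// sumr_ge0// => m _.
exact/ltW/kappa_gt0.
Qed.

Lemma loo_objective_differentiable (R : realType) (d n C : nat) (tau : R)
    (y : 'I_n -> 'I_C) (Z : 'M[R]_(d, n)) :
  (forall c : 'I_C, (2 <= #|[set i | y i == c]%SET|)%N) ->
  differentiable (@loo_objective R d n C tau y) Z.
Proof.
move=> hy; rewrite (_ : loo_objective _ _ = - (fun Y => n%:R^-1 *
    (\sum_(i < n) fun Y : 'M[R]_(d, n) => ln (loo_prob tau y Y i)) Y));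
    last by apply/funext => Y; rewrite /loo_objective /= fct_sumE.
apply: differentiableN; apply: differentiableM => //.
apply: differentiable_sum => i.
have [j ji] : exists j, j != i.
  have /card_gt1P[a [b [_ _ ab]]] := hy (y i).
  by have [ai|ai] := eqVneq a i; [exists b; rewrite -ai eq_sym|exists a].
apply: (@differentiable_comp _ _ _ _
  (fun Y : 'M[R]_(d, n) => loo_prob tau y Y i) (@ln R)).
  exact: loo_prob_differentiable ji.
apply/derivable1_diffP; apply: ex_derive; apply: is_derive1_ln.
exact: loo_prob_gt0.
Qed.

(* Main.v *)
(* The kernel matrix is positive semidefinite because the entrywise powers of a
   Gram matrix are, and exp is a limit of polynomials with nonnegative
   coefficients; adding eps I makes it definite.  The point Ustar solves the
   stationarity equation F = beta Ustar + alpha Ustar K^-1, and completing the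
   square around it shows that Q grows at least like beta / 2 |U - Ustar|^2, so
   that Ustar is the only minimizer.  Pairing the stationarity equation with
   Ustar gives beta |Ustar|^2 <= <F, Ustar>, which turns the descent lemma bound
   - <F, Ustar> + beta / 2 |Ustar|^2 on J(Z + Ustar) - J(Z) into
   - <F, Ustar> / 2. *)
Require Import Defs.
From mathcomp Require Import ring lra.

Set Implicit Arguments.
Unset Strict Implicit.
Unset Printing Implicit Defensive.

Local Open Scope classical_set_scope.
Local Open Scope ring_scope.

(** * The Frobenius inner product and norm *)

Lemma frobC (R : realType) (m n : nat) (A B : 'M[R]_(m, n)) :
  frob A B = frob B A.
Proof. by rewrite /frob -mxtrace_tr trmx_mul trmxK. Qed.

Lemma frobDr (R : realType) (m n : nat) (A B C : 'M[R]_(m, n)) :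
  frob A (B + C) = frob A B + frob A C.
Proof. by rewrite /frob mulmxDr mxtraceD. Qed.

Lemma frobZr (R : realType) (m n : nat) (a : R) (A B : 'M[R]_(m, n)) :
  frob A (a *: B) = a * frob A B.
Proof. by rewrite /frob -scalemxAr mxtraceZ. Qed.

Lemma frobDl (R : realType) (m n : nat) (A B C : 'M[R]_(m, n)) :
  frob (A + B) C = frob A C + frob B C.
Proof. by rewrite frobC frobDr ![frob C _]frobC. Qed.

Lemma frobZl (R : realType) (m n : nat) (a : R) (A B : 'M[R]_(m, n)) :
  frob (a *: A) B = a * frob A B.
Proof. by rewrite frobC frobZr frobC. Qed.

Lemma frobNl (R : realType) (m n : nat) (A B : 'M[R]_(m, n)) :
  frob (- A) B = - frob A B.
Proof. by rewrite -scaleN1r frobZl mulN1r. Qed.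

Lemma frob_mulmx_sym (R : realType) (m n : nat) (P : 'M[R]_n)
    (A B : 'M[R]_(m, n)) :
  P^T = P -> frob A (B *m P) = frob (A *m P) B.
Proof.
by move=> symP; rewrite /frob trmx_mul symP mulmxA mxtrace_mulC mulmxA.
Qed.

Lemma frob_ge0 (R : realType) (m n : nat) (A : 'M[R]_(m, n)) : 0 <= frob A A.
Proof.
rewrite frob_sum; apply: sumr_ge0 => i _; apply: sumr_ge0 => j _.
by rewrite -expr2 sqr_ge0.
Qed.

Lemma frob_eq0 (R : realType) (m n : nat) (A : 'M[R]_(m, n)) :
  (frob A A == 0) = (A == 0).
Proof.
apply/eqP/eqP => [|->]; last by rewrite /frob mulmx0 mxtrace0.
rewrite frob_sum => /eqP; rewrite psumr_eq0 => [/allP A0|i _]; last first.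
  by apply: sumr_ge0 => j _; rewrite -expr2 sqr_ge0.
apply/matrixP => i j; rewrite mxE.
have := A0 i (mem_index_enum i); rewrite psumr_eq0 => [/allP/(_ j)|k _].
  by rewrite mem_index_enum -expr2 sqrf_eq0 => /(_ isT)/eqP.
by rewrite -expr2 sqr_ge0.
Qed.

Lemma frob_norm_ge0 (R : realType) (m n : nat) (A : 'M[R]_(m, n)) :
  0 <= frob_norm A.
Proof. exact: sqrtr_ge0. Qed.

Lemma frob_norm_sqr (R : realType) (m n : nat) (A : 'M[R]_(m, n)) :
  frob_norm A ^+ 2 = frob A A.
Proof. by rewrite sqr_sqrtr ?frob_ge0. Qed.

Lemma frob_normZ (R : realType) (m n : nat) (a : R) (A : 'M[R]_(m, n)) :
  frob_norm (a *: A) = `|a| * frob_norm A.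
Proof.
by rewrite /frob_norm frobZl frobZr mulrA -expr2 sqrtrM ?sqr_ge0// sqrtr_sqr.
Qed.

Lemma frob_CauchySchwarz (R : realType) (m n : nat) (A B : 'M[R]_(m, n)) :
  frob A B <= frob_norm A * frob_norm B.
Proof.
set a := frob_norm A; set b := frob_norm B.
have [ab0|ab0] := ltP 0 (a * b); last first.
  have : a * b = 0 by apply/eqP; rewrite eq_le ab0 mulr_ge0 ?frob_norm_ge0.
  move/eqP; rewrite mulf_eq0 -[a == 0]sqrf_eq0 -[b == 0]sqrf_eq0.
  rewrite !frob_norm_sqr !frob_eq0 => AB0.
  apply: (@le_trans _ _ 0); last by rewrite mulr_ge0 ?frob_norm_ge0.
  by case/orP : AB0 => /eqP ->; rewrite /frob ?trmx0 ?mul0mx ?mulmx0 mxtrace0.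
(* With [a] and [b] the norms of [A] and [B], expanding this square gives
   [2 a^2 b^2 - 2 a b <A, B> >= 0]; the positive factor [a b] then cancels. *)
have := frob_ge0 (b *: A + (- a) *: B).
rewrite !frobDl !frobDr !frobZl !frobZr (frobC B) -!frob_norm_sqr -/a -/b => h.
rewrite -(ler_pM2l ab0); nra.
Qed.

(** * Quadratic forms and positive definiteness of the kernel matrix *)

Lemma quad_formE (R : realType) (n : nat) (K : 'M[R]_n) (v : 'cV[R]_n) :
  (v^T *m K *m v) 0 0 = \sum_i \sum_j v i 0 * v j 0 * K i j.
Proof.
rewrite mxE exchange_big /=; apply: eq_bigr => j _.
by rewrite mxE mulr_suml; apply: eq_bigr => i _; rewrite !mxE mulrAC.
Qed.

Lemma posdef_add_scalar (R : realType) (n : nat) (eps : R) (K : 'M[R]_n) :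
  0 < eps -> K^T = K -> (forall v : 'cV[R]_n, 0 <= (v^T *m K *m v) 0 0) ->
  posdef (K + eps%:M).
Proof.
move=> eps0 symK K0; split=> [|v v0].
  by rewrite linearD /= symK tr_scalar_mx.
rewrite mulmxDr mulmxDl mxE ltr_wpDl// mul_mx_scalar -scalemxAl mxE mulr_gt0//.
have -> : (v^T *m v) 0 0 = frob v v by rewrite /frob /mxtrace big_ord1.
by rewrite lt_def frob_eq0 v0 frob_ge0.
Qed.

Lemma posdef_ge0 (R : realType) (n : nat) (K : 'M[R]_n) (v : 'cV[R]_n) :
  posdef K -> 0 <= (v^T *m K *m v) 0 0.
Proof.
move=> [_ K0]; have [->|v0] := eqVneq v 0; first by rewrite mulmx0 mxE.
exact/ltW/K0.
Qed.

Lemma posdef_unitmx (R : realType) (n : nat) (K : 'M[R]_n) :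
  posdef K -> K \in unitmx.
Proof.
move=> [_ K0]; rewrite unitmxE unitfE; apply/det0P => -[v v0 vK].
have /K0 : v^T != 0 by rewrite trmx_eq0.
by rewrite trmxK vK mul0mx mxE ltxx.
Qed.

(** The pairing is the trace of [A *m K *m A^T], whose diagonal entries are the values of the form
    of [K] at the rows of [A]. *)
Lemma posdef_frob_ge0 (R : realType) (m n : nat) (K : 'M[R]_n)
    (A : 'M[R]_(m, n)) :
  posdef K -> 0 <= frob A (A *m K).
Proof.
move=> pK; rewrite /frob mxtrace_mulC; apply: sumr_ge0 => i _.
have -> : (A *m K *m A^T) i i = ((col i A^T)^T *m K *m col i A^T) 0 0.
  rewrite -tr_row trmxK -row_mul [LHS]mxE [RHS]mxE.
  by apply: eq_bigr => k _; rewrite [row i _ _ _]mxE [(row _ _)^T _ _]mxE !mxE.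
exact: posdef_ge0.
Qed.

(* Induction on the exponent: expanding one factor of the Gram matrix absorbs
   its entries into the weights. *)
Lemma gram_power_ge0 (R : realType) (d n k : nat) (Z : 'M[R]_(d, n))
    (v : 'I_n -> R) :
  0 <= \sum_i \sum_j v i * v j * (((col i Z)^T *m col j Z) 0 0) ^+ k.
Proof.
elim: k v => [|k IHk] v.
  rewrite (_ : \sum_i _ = (\sum_i v i) ^+ 2) ?sqr_ge0// expr2 mulr_suml.
  apply: eq_bigr => i _; rewrite mulr_sumr.
  by apply: eq_bigr => j _; rewrite mulr1.
rewrite (_ : \sum_i _ = \sum_l \sum_i \sum_j (v i * Z l i) * (v j * Z l j) *
    (((col i Z)^T *m col j Z) 0 0) ^+ k); first exact: sumr_ge0.
rewrite [RHS]exchange_big; apply: eq_bigr => i _.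
rewrite [RHS]exchange_big; apply: eq_bigr => j _.
rewrite exprS mulrA -mulr_suml; congr (_ * _).
rewrite mxE mulr_sumr; apply: eq_bigr => l _; rewrite !mxE; ring.
Qed.

Lemma kappa_matrix_ge0 (R : realType) (d n : nat) (tau : R) (Z : 'M[R]_(d, n))
    (v : 'cV[R]_n) :
  0 <= tau ->
  0 <= (v^T *m (\matrix_(i, j) kappa tau (col i Z) (col j Z)) *m v) 0 0.
Proof.
move=> tau0; rewrite quad_formE.
pose x i j := tau * ((col i Z)^T *m col j Z) 0 0.
(* The quadratic form with each exponential replaced by a partial sum of its power series. *)
pose s N := \sum_i \sum_j v i 0 * v j 0 * series (exp_coeff (x i j)) N.
have s0 N : 0 <= s N.
  (* Summing over the degree first writes [s N] as a combination of the forms of Gram powers, with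
     weights [tau ^+ k / k!] that are nonnegative since [tau] is. *)
  rewrite (_ : s N = \sum_(0 <= k < N) (tau ^+ k / k`!%:R) *
    \sum_i \sum_j v i 0 * v j 0 * (((col i Z)^T *m col j Z) 0 0) ^+ k).
    apply: sumr_ge0 => k _; rewrite mulr_ge0 ?divr_ge0 ?exprn_ge0//.
    exact: gram_power_ge0.
  under [RHS]eq_bigr do rewrite mulr_sumr.
  rewrite exchange_big; apply: eq_bigr => i _.
  under [RHS]eq_bigr do rewrite mulr_sumr.
  rewrite exchange_big; apply: eq_bigr => j _.
  rewrite mulr_sumr; apply: eq_bigr => k _.
  by rewrite /exp_coeff /x /= exprMn; ring.
have sl : s @ \oo --> \sum_i \sum_j v i 0 * v j 0 *
    (\matrix_(i, j) kappa tau (col i Z) (col j Z)) i j.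
  apply: cvg_big => [|i _]; first exact: add_continuous.
  apply: cvg_big => [|j _]; first exact: add_continuous.
  apply: cvgMr.
  (* [expR] is by definition the limit of this series, so convergence of the series suffices. *)
  rewrite mxE; exact: is_cvg_series_exp_coeff.
rewrite -(cvg_lim _ sl)//; apply: limr_ge; last exact: nearW.
by apply/cvg_ex; eexists; exact: sl.
Qed.

Lemma reg_kernel_posdef (R : realType) (d n : nat) (tau eps : R)
    (Z : 'M[R]_(d, n)) :
  0 <= tau -> 0 < eps -> posdef (reg_kernel tau eps Z).
Proof.
move=> tau0 eps0; apply: posdef_add_scalar => // [|v]; last first.
  exact: kappa_matrix_ge0.
apply/matrixP => i j; rewrite !mxE /kappa; congr (expR (_ * _)).
by rewrite -[in LHS](trmxK (col i Z)) -trmx_mul mxE.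
Qed.

(** * The regularized quadratic objective and its minimizer *)

Section Proximal.
Variables (R : realType) (d n : nat) (alpha beta : R).
Variables (F : 'M[R]_(d, n)) (K : 'M[R]_n).
Hypotheses (alpha0 : 0 < alpha) (beta0 : 0 < beta) (pK : posdef K).

Let Ustar : 'M[R]_(d, n) := F *m K *m invmx (beta *: K + alpha%:M).

Let trP : (invmx K)^T = invmx K.
Proof. by rewrite trmx_inv (proj1 pK). Qed.

(** The form of [K] at [V *m invmx K] equals the form of [invmx K] at [V]. *)
Lemma frob_invmx_ge0 (V : 'M[R]_(d, n)) : 0 <= frob V (V *m invmx K).
Proof.
have := posdef_frob_ge0 (V *m invmx K) pK.
by rewrite mulmxKV ?posdef_unitmx// frobC.
Qed.

(** The right-hand side factors as [Ustar *m (beta *: K + alpha%:M) *m invmx K], and both inverses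
    cancel against the definition of [Ustar]. *)
Lemma prox_stationary : F = beta *: Ustar + alpha *: (Ustar *m invmx K).
Proof.
have uK := posdef_unitmx pK.
have uM : beta *: K + alpha%:M \in unitmx.
  apply/posdef_unitmx/posdef_add_scalar => // [|v].
    by rewrite linearZ /= (proj1 pK).
  by rewrite -scalemxAr -scalemxAl mxE mulr_ge0 ?posdef_ge0// ltW.
have -> : beta *: Ustar + alpha *: (Ustar *m invmx K) =
    Ustar *m (beta *: K + alpha%:M) *m invmx K.
  rewrite mulmxDr mulmxDl -scalemxAr -scalemxAl mulmxK//.
  by rewrite mul_mx_scalar -scalemxAl.
by rewrite mulmxKV// mulmxK.
Qed.

Lemma prox_frob_ge : beta * frob Ustar Ustar <= frob F Ustar.
Proof.
rewrite {1}prox_stationary frobDl !frobZl lerDl mulr_ge0 ?(ltW alpha0)//.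
by rewrite frobC frob_invmx_ge0.
Qed.

Lemma local_objective_growth (U : 'M[R]_(d, n)) :
  local_objective alpha beta F K Ustar +
    beta / 2 * frob (U - Ustar) (U - Ustar) <=
  local_objective alpha beta F K U.
Proof.
have trE (W : 'M[R]_(d, n)) : \tr (W *m invmx K *m W^T) = frob W (W *m invmx K).
  by rewrite /frob [RHS]mxtrace_mulC.
rewrite /local_objective !frob_norm_sqr !trE.
have := frob_invmx_ge0 (U - Ustar); set V := U - Ustar => V0.
have : U = Ustar + V by rewrite /V addrC subrK.
move: V V0 => V V0 ->.
rewrite mulmxDl !(frobDr, frobDl) (frobC V Ustar) [frob V (Ustar *m _)]frobC.
rewrite (frob_mulmx_sym Ustar V trP).
(* Pairing the stationarity equation with [V] cancels the terms linear in [V]; the surplus left over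
   is [alpha / 2 * frob V (V *m invmx K)]. *)
have -> : frob F V = beta * frob Ustar V + alpha * frob (Ustar *m invmx K) V.
  by rewrite {1}prox_stationary frobDl !frobZl.
have := mulr_ge0 (ltW alpha0) V0; lra.
Qed.

Lemma local_objective_minimizer (U : 'M[R]_(d, n)) :
  minimizer (local_objective alpha beta F K) U <-> U = Ustar.
Proof.
split=> [minU|-> V]; last first.
  apply: le_trans (local_objective_growth V).
  by rewrite lerDl mulr_ge0 ?frob_ge0// divr_ge0// ltW.
apply/eqP; rewrite -subr_eq0 -frob_eq0 eq_le frob_ge0 andbT.
(* Growth around [Ustar] together with minimality of [U] forces the squared distance between them to
   be at most 0. *)
have := le_trans (local_objective_growth U) (minU Ustar).
by rewrite gerDl pmulr_rle0// divr_gt0.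
Qed.

End Proximal.

(** * Derivatives along a segment and the descent lemma *)

Lemma is_derive_line (R : realType) (m n : nat) (f : 'M[R]_(m, n) -> R)
    (Z U : 'M[R]_(m, n)) (t : R) :
  differentiable f (Z + t *: U) ->
  is_derive t 1 (fun s : R => f (Z + s *: U)) (frob (grad f (Z + t *: U)) U).
Proof.
move=> df.
(* The summand [0] is the differential of the constant [Z]. *)
have dg : is_diff t (fun s : R => Z + s *: U) (fun s => 0 + s *: U).
  exact: is_diffD.
have fE : is_diff (Z + t *: U) f ('d f (Z + t *: U)) by exact: differentiableP.
have h := is_diff_comp dg fE.
apply: DeriveDef; first by apply/derivable1_diffP; case: h.
rewrite deriveE; last by case: h.
by rewrite (@diff_val _ _ _ _ _ _ _ h) /= add0r scale1r gradP.
Qed.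

(** Subtracting the claimed quadratic bound from [f] along the segment leaves a function [g] with
    nonpositive derivative, so a single use of the mean value theorem replaces integration of the
    gradient. *)
Lemma smooth_descent (R : realType) (m n : nat) (beta : R)
    (f : 'M[R]_(m, n) -> R) (S : set 'M[R]_(m, n)) (Z U : 'M[R]_(m, n)) :
  (forall X, S X -> differentiable f X) ->
  [set Z + t *: U | t in `[0, 1]] `<=` S -> smooth_on beta f S ->
  f (Z + U) - f Z <= frob (grad f Z) U + beta / 2 * frob U U.
Proof.
move=> df segS smf.
have inS (t : R) : 0 <= t <= 1 -> S (Z + t *: U).
  by move=> t01; apply: segS; exists t => //=; rewrite in_itv.
pose c := frob (grad f Z) U; pose b := beta * frob U U / 2.
pose g (t : R) := f (Z + t *: U) - (c * t + b * t ^+ 2).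
pose dg (t : R) := frob (grad f (Z + t *: U)) U - (c + b * (2 * t)).
have gd (t : R) : 0 <= t <= 1 -> is_derive t 1 g (dg t).
  move=> t01; apply: is_deriveB; first exact/is_derive_line/df/inS.
  apply: is_derive_eq.
  by rewrite /GRing.scale /=; ring.
have [||t] := @MVT_segment R g dg 0 1 ler01.
- by move=> t; rewrite in_itv /= => /andP[t0 t1]; apply: gd; rewrite !ltW.
- apply: continuous_in_subspaceT => t; rewrite inE /= in_itv /= => t01.
  apply: differentiable_continuous; apply/derivable1_diffP.
  by have [] := gd t t01.
rewrite in_itv /= subr0 mulr1 => t01 gE.
have : dg t <= 0.
  have -> : dg t =
      frob (grad f (Z + t *: U) - grad f Z) U - beta * t * frob U U.
    by rewrite /dg frobDl frobNl opprD addrA mulrA divfK ?pnatr_eq0// mulrAC.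
  have t0 : 0 <= t by case/andP: t01.
  (* Cauchy-Schwarz, then the Lipschitz bound between [Z + t *: U] and [Z], which lie at distance
     [t * frob_norm U]. *)
  rewrite subr_le0 (le_trans (frob_CauchySchwarz _ _))//.
  rewrite -frob_norm_sqr expr2 mulrA.
  apply: ler_wpM2r; first exact: frob_norm_ge0.
  have SZ : S Z.
    by rewrite -[Z]addr0 -(scale0r U); apply: inS; rewrite lexx ler01.
  have := smf _ _ (inS t t01) SZ.
  by rewrite (addrC Z) addrK frob_normZ ger0_norm// mulrA.
rewrite -gE /g scale1r scale0r addr0 /b /c; lra.
Qed.

Theorem proposition1 (R : realType) (n d C : nat)
    (hn : (1 <= n)%N) (hd : (1 <= d)%N) (hC : (1 <= C)%N)
    (y : 'I_n -> 'I_C) (hy : forall c : 'I_C, (2 <= #|[set i | y i == c]%SET|)%N)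
    (tau eps alpha beta : R)
    (htau : 0 < tau) (heps : 0 < eps) (halpha : 0 < alpha) (hbeta : 0 < beta)
    (Z : 'M[R]_(d, n)) :
  let J := @loo_objective R d n C tau y in
  let F := - grad J Z in
  let K := reg_kernel tau eps Z in
  let Q := local_objective alpha beta F K in
  let Ustar := F *m K *m invmx (beta *: K + alpha%:M) in
  [/\ posdef K,
      forall U, minimizer Q U <-> U = Ustar &
      forall S : set 'M[R]_(d, n),
        set_nbhs [set Z + t *: Ustar | t in `[0, 1]] S ->
        smooth_on beta J S ->
        J (Z + Ustar) - J Z <= - (2^-1 * frob F Ustar) <= 0].
Proof.
move=> J F K Q Ustar.
have pK : posdef K by apply: reg_kernel_posdef => //; exact: ltW.
split=> // [U|S nS smJ]; first exact: local_objective_minimizer.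
have FU : beta * frob Ustar Ustar <= frob F Ustar by exact: prox_frob_ge.
have : J (Z + Ustar) - J Z <=
    frob (grad J Z) Ustar + beta / 2 * frob Ustar Ustar.
  apply: (smooth_descent _ _ smJ) => [X _|].
    exact: loo_objective_differentiable.
  by move=> X segX; apply: nbhs_singleton; exact: nS.
have -> : frob (grad J Z) Ustar = - frob F Ustar by rewrite -frobNl opprK.
have := mulr_ge0 (ltW hbeta) (frob_ge0 Ustar).
(* Here [u] stands for the squared norm of [Ustar] and [v] for [frob F Ustar]: half of
   [beta * u <= v] gives the first bound, and [0 <= beta * u <= v] the sign. *)
have J_le (a u v : R) : beta * u <= v -> 0 <= beta * u ->
    a <= - v + beta / 2 * u -> a <= - (2^-1 * v) <= 0.
  by move=> *; apply/andP; split; lra.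
exact: J_le.
Qed.
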